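(* Let $(D_n)_{n\ge1}$ be connected regular domains of the family $\mathcal D$ such that $x_0\in D_1$, $D_n\Subset D_{n+1}$ for all $n$, and $D=\bigcup_{n\ge1}D_n$, and suppose that for every $n$ the relative kernel $K_{D_n}$ has a jointly continuous version on $D_n\times\partial D_n$ (this version is used). Put $L_m=\overline{D_m}$. Then $\mathcal H_1(D)$ is compact and metrizable in the topology of locally uniform convergence. Moreover, there are nonempty compact convex sets $\mathcal Q_m\subset C(L_m)$ ($m\ge1$), consisting of functions harmonic in $D_m$, such that: 1. $g|_{L_m}\in\mathcal Q_m$ for every $g\in\mathcal H_1(D)$; 2. $K_{D_n}(\cdot,y)|_{L_m}\in\mathcal Q_m$ whenever $n\ge m+2$ and $y\in\partial D_n$; 3. restriction defines continuous maps $R_{\ell m}:\mathcal Q_\ell\to\mathcal Q_m$, $\ell>m$, and $\mathcal H_1(D)$ is homeomorphic to the inverse limit $\varprojlim_m\mathcal Q_m$ of this system.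
   Context: Let $X$ be a metric space. A domain is a nonempty connected open set; $V\Subset U$ means that $\overline V$ is compact and contained in $U$. Measures are positive Borel measures (completed when integrable functions are considered). A harmonic measure on a domain $U$ with $\partial U\ne\varnothing$ is a family $\{\omega_x^U:x\in U\}$ of measures on $\partial U$ with $\omega_x^U(\partial U)=1$ and $\omega_x^U\ll\omega_y^U$ for all $x,y\in U$; write $\omega_x^U(f)=\int_{\partial U}f\,d\omega_x^U$. It is continuous if $x\mapsto\omega_x^U(f)$ is continuous on $U$ for every $f\in\bigcap_{x\in U}L^1(\partial U,\omega_x^U)$, and Radon if every $\omega_x^U$ is Radon. The domain $U$ is regular if for every $\zeta\in\partial U$ and every bounded Borel $f$ on $\partial U$ continuous at $\zeta$ one has $\omega_x^U(f)\to f(\zeta)$ as $U\ni x\to\zeta$. Standing framework: $\mathcal D$ is a family of domains of $X$, each with nonempty boundary and equipped with a continuous Radon harmonic measure, such that (i) every $U\in\mathcal D$ is the union of an increasing sequence of regular domains of $\mathcal D$ whose closures are compact and contained in $U$; (ii) for $V\Subset U$ in $\mathcal D$ with $V$ regular, $\omega_x^U(f)=\int_{\partial V}\omega_y^U(f)\,d\omega_x^V(y)$ for all $x\in V$ and all bounded Borel $f$ on $\partial U$. $D\subseteq X$ is a domain and $x_0\in D$ is fixed. A function $u:W\to\mathbb R$ on an open set $W$ is harmonic if it is continuous and $u(x)=\int_{\partial V}u\,d\omega_x^V$ for every regular $V\in\mathcal D$ with $V\Subset W$ and every $x\in V$. $\mathcal H_1(D)$ is the set of strictly positive harmonic functions $h$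 on $D$ with $h(x_0)=1$. For regular $U\in\mathcal D$ with $U\Subset D$, $x_0\in U$, the relative kernel is $K_U(x,y)=\frac{d\omega_x^U}{d\omega_{x_0}^U}(y)$, $x\in U$, $y\in\partial U$. $C(L_m)$ carries the uniform norm. *)

(* Defs.v *)
From HB Require Import structures.
From mathcomp Require Import all_boot all_order all_algebra.
From mathcomp Require Import all_classical all_reals all_analysis.

Set Implicit Arguments.
Unset Strict Implicit.
Unset Printing Implicit Defensive.

Import Order.TTheory GRing.Theory Num.Theory.
Import numFieldNormedType.Exports.

Local Open Scope classical_set_scope.
Local Open Scope ring_scope.

(* A measurableType must be pointed, so "metric space" is read as "nonempty
   metric space"; the distinguished point plays no mathematical role. *)
#[short(type="pmetricType")]
HB.structure Definition PMetric (K : numDomainType) :=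
  { M of Pointed M & Metric K M }.

Notation borel X := (g_sigma_algebraType (@open X)).

Definition bdry {T : topologicalType} (U : set T) : set T := closure U `\` U°.

Definition is_domain {T : topologicalType} (U : set T) : Prop :=
  [/\ open U, U !=set0 & connected U].

Definition precompact_in {T : topologicalType} (V U : set T) : Prop :=
  compact (closure V) /\ closure V `<=` U.

(* A genuine restriction only when [A `<=` B]; outside [B] it takes the value
   [v]. *)
Definition restr {X V : Type} (v : V) {B : set X} (A : set X) (f : B -> V) :
  A -> V := sigL A ('valL_ v f).

Arguments restr {X V} v {B} A f.

Section harmonic_measures.
Context {R : realType} {X : pmetricType R}.
Implicit Types (U V W : set X) (f : X -> R).

Definition radon (mu : {measure set (borel X) -> \bar R}) : Prop :=
  (forall x : X, exists2 A : set X,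
     open_nbhs x A & (mu A < +oo)%E) /\
  (forall A : set (borel X), measurable A ->
     mu A = ereal_sup [set mu K | K in [set K | compact (K : set X) /\ K `<=` A]]).

Definition completed_L1 (mu : {measure set (borel X) -> \bar R}) (A : set X) f
    : Prop :=
  exists2 g : X -> R, mu.-integrable A (EFin \o g) & f = g %[ae mu in A].

Definition bounded_borel (A : set X) f : Prop :=
  measurable_fun (A : set (borel X)) f /\ [bounded f y | y in A].

(* A measure on [bdry U] is encoded as a Borel measure on X concentrated on the
   closed set [bdry U]. *)
Definition harmonic_measure U (w : X -> probability (borel X) R) : Prop :=
  [/\ bdry U !=set0, (forall x, U x -> w x (bdry U) = 1%E) &
      (forall x y, U x -> U y -> w x `<< w y)].

(* Here [f] may fail to be Borel, but the library integral of a nonnegative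
   function is a supremum over the Borel simple functions below it, which for
   [f] in [completed_L1] is the integral against the completed measure. *)
Definition continuous_harmonic_measure U (w : X -> probability (borel X) R)
    : Prop :=
  forall f, (forall x, U x -> completed_L1 (w x) (bdry U) f) ->
    {within U, continuous (fun x => \int[w x]_(y in bdry U) f y)}.

Definition regular_domain U (w : X -> probability (borel X) R) : Prop :=
  forall (zeta : X) f, bdry U zeta -> bounded_borel (bdry U) f ->
    f @ within (bdry U) (nbhs zeta) --> f zeta ->
    (\int[w x]_(y in bdry U) f y) @[x --> within U (nbhs zeta)] --> f zeta.

(* [omega U x] is only meaningful for [U] in the family and [x] in [U]. *)
Record harmonic_framework (Dfam : set (set X))
    (omega : set X -> X -> probability (borel X) R) : Prop := {
  framework_domain : forall U, Dfam U -> is_domain U ;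
  framework_measure : forall U, Dfam U -> harmonic_measure U (omega U) ;
  framework_continuous : forall U, Dfam U ->
    continuous_harmonic_measure U (omega U) ;
  framework_radon : forall U x, Dfam U -> U x -> radon (omega U x) ;
  framework_exhaustion : forall U, Dfam U -> exists V : nat -> set X,
    [/\ (forall n,
           [/\ Dfam (V n), regular_domain (V n) (omega (V n)) &
               precompact_in (V n) U]),
        (forall n, V n `<=` V n.+1) &
        U = \bigcup_n V n] ;
  framework_mean : forall U V, Dfam U -> Dfam V -> precompact_in V U ->
    regular_domain V (omega V) ->
    forall f x, bounded_borel (bdry U) f -> V x ->
      \int[omega U x]_(z in bdry U) f z =
      \int[omega V x]_(y in bdry V) (\int[omega U y]_(z in bdry U) f z)
}.

(* Depends only on the values of [u] on the open set [W]: a function on a set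
   containing [W] is passed through an arbitrary extension to X, e.g. ['valL_]. *)
Definition harmonic_on (Dfam : set (set X))
    (omega : set X -> X -> probability (borel X) R) W (u : X -> R) : Prop :=
  {within W, continuous u} /\
  forall V x, Dfam V -> regular_domain V (omega V) -> precompact_in V W -> V x ->
    u x = \int[omega V x]_(y in bdry V) u y.

(* On the locally compact sets [D] of interest, [{family compact, D -> R}] is the
   topology of locally uniform convergence, see
   [family_compact_locally_uniform] below. *)
Definition normalized_harmonic (Dfam : set (set X))
    (omega : set X -> X -> probability (borel X) R) (D : set X) (x0 : X)
    : set {family compact, D -> R} :=
  [set h : D -> R | [/\ harmonic_on Dfam omega D ('valL_ 0 h),
                        (forall x, 0 < h x) & 'valL_ 0 h x0 = 1]].

Definition relative_kernel (U : set X) (w : X -> probability (borel X) R)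
    (x0 : X) (K : X -> X -> R) : Prop :=
  forall x, U x ->
    (EFin \o K x) =
    Radon_Nikodym (charge_of_finite_measure (w x)) (w x0)
    %[ae (w x0) in bdry U].

End harmonic_measures.

Arguments normalized_harmonic {R X} Dfam omega D x0.

Definition metrizable (R : realType) (T : topologicalType) : Prop :=
  exists d : T -> T -> R,
    [/\ [/\ (forall x y, 0 <= d x y),
            (forall x y, d x y = 0 <-> x = y),
            (forall x y, d x y = d y x) &
            (forall x y z, d x z <= d x y + d y z)] &
        (forall x (A : set T),
           nbhs x A <-> exists2 e : R, 0 < e & [set y | d x y < e] `<=` A)].

Definition homeomorphic (S T : topologicalType) : Prop :=
  exists (f : S -> T) (g : T -> S),
    [/\ continuous f, continuous g, cancel f g & cancel g f].

(* Subspace of the product topology, hence of the product of the [Q m]. *)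
Definition inverse_limit (T : nat -> topologicalType) (Q : forall m, set (T m))
    (r : forall l m, T l -> T m) : set (prod_topology T) :=
  [set q | (forall m, Q m (q m)) /\
           (forall l m, (m < l)%N -> r l m (q l) = q m)].

Lemma family_compact_locally_uniform (T : topologicalType) (V : uniformType)
    (F : set_system (T -> V)) (f : T -> V) : Filter F ->
  (forall x : T, exists2 K : set T, nbhs x K & compact K) ->
  {family compact, F --> f} <->
  (forall x : T, exists2 A : set T, nbhs x A & {uniform A, F --> f}).
Proof.
move=> FF lc; split=> [/fam_cvgP Ff x|loc].
  by have [K xK cK] := lc x; exists K => //; exact: Ff.
apply/fam_cvgP => K /compact_near_coveringP cK P /uniform_nbhs [E [entE EP]].
suff : \forall g \near F, K `<=` [set y | E (f y, g y)].
  by apply: filterS => g Kg; apply: EP => y Ky; exact: Kg.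
have := cK _ F (fun (g : T -> V) y => E (f y, g y)) FF; apply => x Kx.
have [A xA FA] := loc x.
exists (A, [set h : T -> V | forall y, A y -> E (f y, h y)]) => /=.
  by split=> //; apply: FA; apply/uniform_nbhs; exists E; split.
by move=> [y g] /= [Ay Eg]; exact: Eg.
Qed.

(* Main.v *)
Require Import Defs.
From mathcomp Require Import all_boot all_order all_algebra.
From mathcomp Require Import all_classical all_reals all_analysis.
From mathcomp Require Import measurable_realfun lra.
Import Order.TTheory GRing.Theory Num.Theory.
Import numFieldNormedType.Exports.
Local Open Scope classical_set_scope.
Local Open Scope ring_scope.

Set Implicit Arguments.
Unset Strict Implicit.
Unset Printing Implicit Defensive.

(** Let u >= 0 be harmonic on a neighbourhood of the closure of D_n, with
    u(x0) = 1. The mean value property on D_n says that u(x) is the integral of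
    K_n(x, .) against the probability measure u d omega_(x0) on the boundary, so
      |u(x) - u(x')| <= sup_y |K_n(x, y) - K_n(x', y)|.
    The right-hand side does not involve u, and it tends to 0 as x' tends to x
    because K_n is jointly continuous and the boundary is compact. Hence all
    such u are equicontinuous and pointwise bounded on D_n
    ([normalized_harmonic_oscillation] and the two lemmas after it), and Ascoli's
    theorem provides every compactness claim. Uniform limits of harmonic
    functions are harmonic, and a nonnegative harmonic function that vanishes at
    x vanishes omega_x-almost everywhere on the boundary, hence
    omega_(x0)-almost everywhere, hence at x0 ([normalized_harmonic_gt0]); so
    strict positivity survives in the limit, and H_1(D) is closed.

    The functions K_n(., y) themselves are normalized nonnegative harmonic
    functions, at every single y although the densities are a priori determined
    almost everywhere only. Indeed regularity forces omega_x to charge every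
    neighbourhood of every boundary point ([harmonic_measure_support]), so by
    continuity K_n(x, y) is the limit, uniform for x in a compact set, of
    omega_x(N) / omega_(x0)(N) as N shrinks to y; these quotients have the mean
    value property in x, and it passes to the limit ([kernel_harmonic]).

    Q_m is the closure in C(L_m) of the restrictions to L_m of the normalized
    nonnegative harmonic functions on D_(m+2). Between L_m and D_(m+2) there is
    exactly one more domain D_(m+1), whose kernel controls these functions on
    L_m. The set is convex, it contains K_n(., y) for n >= m + 2 since that
    function is already harmonic on D_(m+2), and restrictions map Q_l into Q_m
    since D_(m+2) is contained in D_(l+2). A compatible sequence of the inverse
    limit glues to one function on D, which is harmonic because the compact
    closure of a test domain lies in some D_n ([harmonic_bigcup]); closeness on
    a compact subset of D amounts to closeness on one L_n, so gluing and
    restricting are continuous ([homeomorphic_inverse_limit]). *)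

(** * Function spaces and Ascoli's theorem *)

Section topology.
Context {R : realType}.

Lemma nbhs_set_typeP (T : topologicalType) (A : set T) (x : A) (U : set A) :
  nbhs x U <-> exists2 V, nbhs (set_val x) V & set_val @^-1` V `<=` U.
Proof.
split=> [[_ [[W oW <-] /= Wx WU]]|[V + VU]].
  by exists W => //; exact: open_nbhs_nbhs.
rewrite nbhsE => -[W [oW Wx] WV]; exists (set_val @^-1` W); split.
- by exists W.
- exact: Wx.
- by move=> z /WV; exact: VU.
Qed.

(** Near coverings of the preimage push forward to near coverings of [A],
    because neighbourhoods in [B] are traces of neighbourhoods in [T]. *)
Lemma compact_preimage_val (T : topologicalType) (A B : set T) :
  compact A -> A `<=` B -> compact (set_val @^-1` A : set B).
Proof.
move=> /compact_near_coveringP cA AB; apply/compact_near_coveringP => I F P FF cov.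
have : \forall i \near F,
    A `<=` [set x | A x -> forall Bx : x \in B, P i (SigSub Bx)].
  apply: cA => x Ax.
  have [[U V] /= [/nbhs_set_typeP[W xW WU] FV] UVP] :=
    cov (SigSub (mem_set (AB x Ax))) Ax.
  exists (W, V) => //= -[y i] /= [Wy Vi] Ay By.
  by apply: (UVP (_, _)); split => //; exact: WU.
by apply: filterS => i AP [x Bx] /= Ax; exact: (AP x).
Qed.

Lemma compact_set_type (T : topologicalType) (A : set T) :
  compact A -> compact [set: A].
Proof.
move=> cA; have := compact_preimage_val cA (@subset_refl _ A).
by rewrite (_ : _ @^-1` A = setT)//; apply/seteqP; split=> x // _; exact: set_valP.
Qed.

Lemma compact_image_val (T : topologicalType) (A : set T) (C : set A) :
  compact C -> compact (set_val @` C).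
Proof.
move=> cC; apply: continuous_compact => //; apply: continuous_subspaceT.
exact: initial_continuous.
Qed.

Lemma within_continuousP (T : topologicalType) (A : set T) (f : T -> R) :
  {within A, continuous f} <-> forall a, A a -> forall e, 0 < e ->
    \forall x \near a, A x -> `|f a - f x| < e.
Proof.
rewrite subspace_continuousP; split=> cf a Aa.
  by move=> e e0; have /cvgrPdist_lt/(_ e e0) := cf a Aa; rewrite near_withinE.
by apply/cvgrPdist_lt => e e0; rewrite near_withinE; exact: cf.
Qed.

Lemma uniform_ballP (T : choiceType) (f : {uniform T -> R}) (A : set {uniform T -> R}) :
  nbhs f A <->
  exists2 e : R, 0 < e & [set g | forall x, `|f x - g x| < e] `<=` A.
Proof.
rewrite uniform_nbhs; split=> [[E [entE EA]]|[e e0 eA]].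
  move: entE; rewrite -entourage_ballE => -[e /= e0 eE].
  by exists e => // g /= fg; apply: EA => x _; apply: eE; exact: fg.
exists [set xy | ball xy.1 e xy.2]; split.
  by rewrite -entourage_ballE; exists e.
by move=> g fg; apply: eA => x; exact: fg.
Qed.

Lemma closure_uniformP (T : choiceType) (S : set {uniform T -> R})
    (f : {uniform T -> R}) :
  closure S f <->
  forall e, 0 < e -> exists2 s : T -> R, S s & forall x, `|f x - s x| < e.
Proof.
split=> [clS e e0|clS A /uniform_ballP[e e0 eA]].
  have [|s [Ss fs]] := clS [set g : T -> R | forall x, `|f x - g x| < e].
    by apply/uniform_ballP; exists e.
  by exists s.
by have [s Ss fs] := clS e e0; exists s; split => //; exact: eA.
Qed.

Lemma equicontinuous_precompact (T : topologicalType) (S : set (T -> R)) :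
  (forall x e, 0 < e ->
     \forall y \near x, forall f, S f -> `|f x - f y| < e) ->
  (forall x, exists M, forall f, S f -> `|f x| <= M) ->
  precompact (S : set {family compact, T -> R}).
Proof.
move=> eqS bS; apply: pointwise_precompact_equicontinuous.
- exact: Rhausdorff.
- move=> x; have [M SM] := bS x.
  apply: (@precompact_subset _ _ `[- M, M]%classic).
    by move=> _ [f Sf <-]; rewrite /= in_itv/= -ler_norml; exact: SM.
  rewrite precompact_closed; first exact: segment_compact.
  exact: interval_closed.
- move=> x E; rewrite -entourage_ballE => -[e /= e0 eE].
  have := eqS x e e0; apply: filterS => y Sy f Sf; apply: eE; exact: Sy.
Qed.

Lemma equicontinuous_compact_family (T : topologicalType) (S : set (T -> R)) :
  (forall x e, 0 < e ->
     \forall y \near x, forall f, S f -> `|f x - f y| < e) ->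
  (forall x, exists M, forall f, S f -> `|f x| <= M) ->
  closed (S : set {family compact, T -> R}) ->
  compact (S : set {family compact, T -> R}).
Proof.
by move=> eqS bS clS; rewrite -precompact_closed//; exact: equicontinuous_precompact.
Qed.

(** When [T] is compact, it is itself one of the compact sets on which the
    convergence provided by Ascoli's theorem is uniform. *)
Lemma equicontinuous_compact_uniform (T : topologicalType) (S : set (T -> R)) :
  compact [set: T] ->
  (forall x e, 0 < e ->
     \forall y \near x, forall f, S f -> `|f x - f y| < e) ->
  (forall x, exists M, forall f, S f -> `|f x| <= M) ->
  compact (closure (S : set {uniform T -> R})).
Proof.
move=> cT eqS bS.
have := equicontinuous_precompact eqS bS.
rewrite precompactE compact_ultra => cS; rewrite compact_ultra => F UF FS.
have [|f [_ Ff]] := cS F UF.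
  apply: filterS FS => g; rewrite closureEcvg => -[G PG [Gg SG]].
  rewrite closureEcvg; exists G => //; split=> //.
  apply/fam_cvgP => A _.
  exact: (uniform_subset_cvg _ (@subsetT _ A) Gg).
have PF : ProperFilter F by exact: ultra_proper.
have Fuf : F --> (f : {uniform T -> R}) by move/fam_cvgP : Ff; exact.
exists f; split => //.
have := closed_closure; apply.
by rewrite closureEcvg; exists F => //; split => // A clA; exact: filterS clA FS.
Qed.

Lemma homo_subset (T : Type) (L : nat -> set T) :
  (forall n, L n `<=` L n.+1) -> {homo L : m n / (m <= n)%N >-> m `<=` n}.
Proof.
move=> LS; apply: homo_leq => // [A|A B C AB BC]; first exact: subset_refl.
exact: subset_trans BC.
Qed.

(** For a hemicompact space, the sup-norms over the sets of an exhaustion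
    generate the topology of uniform convergence on compact sets. *)
Lemma family_compact_ballP (T : topologicalType) (L : nat -> set T)
    (f : {family compact, T -> R}) (A : set {family compact, T -> R}) :
  (forall n, compact (L n)) ->
  (forall n, L n `<=` L n.+1) ->
  (forall C, compact C -> exists n, C `<=` L n) ->
  nbhs f A <->
  exists n (e : R), 0 < e /\
    [set g | forall x, L n x -> `|f x - g x| < e] `<=` A.
Proof.
move=> cL LS exL; split=> [|[n [e [e0 eA]]]]; last first.
  apply: filterS eA _.
  apply: (@fam_nbhs _ _ compact (L n) [set xy | ball xy.1 e xy.2] f) => //.
  by rewrite -entourage_ballE; exists e.
pose F := filter_from [set ne : nat * R | 0 < ne.2]
    (fun ne => [set g : T -> R | forall x, L ne.1 x -> `|f x - g x| < ne.2]).
have FF : Filter F.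
  apply: filter_from_filter; first by exists (0%N, 1) => /=.
  move=> [m e] [n e'] /= e0 e'0; exists (maxn m n, Num.min e e').
    by rewrite /= lt_min e0.
  move=> g /= fg; split=> x Lx.
    have := fg x (homo_subset LS (leq_maxl m n) Lx).
    by rewrite lt_min => /andP[].
  have := fg x (homo_subset LS (leq_maxr m n) Lx).
  by rewrite lt_min => /andP[].
move: A; suff : {family compact, F --> f}.
  by move=> H A /H [[n e] /= e0 eA]; exists n, e.
apply/fam_cvgP => C cC A /uniform_nbhs [E [entE EA]].
have [n CL] := exL C cC.
move: entE; rewrite -entourage_ballE => -[e /= e0 eE].
exists (n, e) => //= g fg; apply: EA => x Cx; apply: eE.
exact: fg (CL _ Cx).
Qed.

(** Truncating the distance over [L n] at 1 / (n + 1) makes the supremum over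
    n finite without any boundedness of the functions, and leaves only finitely
    many n relevant for closeness to a given precision. *)
Lemma metrizable_family_compact (T : topologicalType) (L : nat -> set T) :
  (forall n, compact (L n)) ->
  (forall n, L n `<=` L n.+1) ->
  (forall C, compact C -> exists n, C `<=` L n) ->
  metrizable R {family compact, T -> R}.
Proof.
move=> cL LS exL.
have covL x : exists n, L n x.
  by have [n nx] := exL _ (@compact_set1 _ x); exists n; exact: nx.
pose w n : R := n.+1%:R^-1.
have w0 n : 0 < w n by rewrite invr_gt0.
pose B (f g : T -> R) : set R :=
  [set r | exists n x, L n x /\ r = Num.min `|f x - g x| (w n)].
pose d (f g : T -> R) := sup (B f g `|` [set 0]).
have B1 f g : has_sup (B f g `|` [set 0]).
  split; first by exists 0; right.
  exists 1 => _ [[n [x [_ ->]]]|->]; last exact: ler01.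
  by rewrite ge_min; apply/orP; right; rewrite invf_le1// ler1n.
have dub f g n x : L n x -> Num.min `|f x - g x| (w n) <= d f g.
  by move=> nx; apply: sup_upper_bound => //; left; exists n, x.
have dge0 f g : 0 <= d f g by apply: sup_upper_bound => //; right.
have dle f g c : 0 <= c ->
    (forall n x, L n x -> Num.min `|f x - g x| (w n) <= c) -> d f g <= c.
  move=> c0 cub; apply: ge_sup; first by exists 0; right.
  by move=> _ [[n [x [nx ->]]]|->//]; exact: cub.
exists d; split; first split.
- exact: dge0.
- move=> f g; split=> [d0|->]; last first.
    apply/eqP; rewrite eq_le dge0 andbT; apply: dle => // n x _.
    by rewrite subrr normr0 ge_min lexx.
  apply/funext => x; have [n nx] := covL x.
  have := dub f g n x nx; rewrite d0 ge_min leNgt [w n <= 0]leNgt w0 orbF.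
  by rewrite -leNgt normr_le0 subr_eq0 => /eqP.
- move=> f g; congr (sup (_ `|` _)); apply/seteqP; split => _ [n [x [nx ->]]];
    by exists n, x; rewrite distrC.
- move=> f g h; apply: dle; first exact: addr_ge0.
  move=> n x nx; apply: (le_trans _ (lerD (dub f g n x nx) (dub g h n x nx))).
  have := ler_distD (g x) (f x) (h x).
  move: `|f x - g x| `|g x - h x| (normr_ge0 (f x - g x))
    (normr_ge0 (g x - h x)) => a b a0 b0 hab.
  rewrite ge_min.
  have [aw|/ltW wa] := leP a (w n); last first.
    by apply/orP; right; rewrite lerDl le_min b0 ltW.
  have [bw|/ltW wb] := leP b (w n); last first.
    by apply/orP; right; rewrite lerDr.
  by rewrite hab.
- move=> f A; rewrite (family_compact_ballP _ _ cL LS exL); split.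
    move=> [n [e [e0 eA]]]; exists (Num.min e (w n)); first by rewrite lt_min e0 w0.
    move=> g /= dfg; apply: eA => x nx; move: dfg; rewrite lt_min => /andP[de dw].
    have := le_lt_trans (dub f g n x nx) dw; rewrite gt_min ltxx orbF => fgw.
    by have := le_lt_trans (dub f g n x nx) de; rewrite /Num.min fgw.
  move=> [e e0 eA].
  have e20 : 0 < e / 2 by rewrite divr_gt0.
  have [n ne] : exists n, w n < e / 2.
    have [n _ /(_ n (leqnn n))] := near_infty_natSinv_lt (PosNum e20).
    by exists n.
  exists n, (e / 2); split => // g fg; apply: eA => /=.
  apply: (@le_lt_trans _ _ (e / 2)); last by rewrite ltr_pdivrMr// ltr_pMr// ltr1n.
  apply: dle => [|k x kx]; first exact: ltW.
  rewrite ge_min; have [kn|nk] := leqP k n.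
    by apply/orP; left; apply/ltW/fg; exact: homo_subset kx.
  apply/orP; right; apply: (le_trans _ (ltW ne)).
  by rewrite lef_pV2 ?posrE// ler_nat ltnS ltnW.
Qed.

Lemma metrizable_subset (T : topologicalType) (A : set T) :
  metrizable R T -> metrizable R A.
Proof.
move=> [d [[d0 dE dC dD] dN]]; exists (fun x y => d (set_val x) (set_val y)).
split; first split => //.
- move=> x y; rewrite dE; split=> [/val_inj|->//]; exact.
- move=> x B; split.
    move=> /nbhs_set_typeP[V /dN[e e0 eV] VB].
    by exists e => // y /= xy; apply: VB; exact: eV.
  move=> [e e0 eB]; apply/nbhs_set_typeP; exists [set y | d (set_val x) y < e] => //.
  by apply/dN; exists e.
Qed.

Lemma within_prod_continuousP (T U : topologicalType) (f : T -> U -> R)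
    (A : set T) (B : set U) :
  {within A `*` B, continuous (fun p => f p.1 p.2)} ->
  forall a b, A a -> B b -> forall e, 0 < e ->
  \forall x \near a & y \near b, A x -> B y -> `|f a b - f x y| < e.
Proof.
move=> /within_continuousP cf a b Aa Bb e e0.
have [[V W] /= [aV bW] VW] := cf (a, b) (conj Aa Bb) e e0.
exists (V, W) => // -[x y] /= VWxy Ax By.
exact: (VW (x, y)).
Qed.

(** The modulus of continuity in the second variable can be chosen uniformly
    over a compact set of the first: this is where joint continuity of the
    kernel is used. *)
Lemma tube_continuous (T U : topologicalType) (f : T -> U -> R) (A C : set T)
    (B : set U) (b : U) (e : R) :
  {within A `*` B, continuous (fun p => f p.1 p.2)} ->
  compact C -> C `<=` A -> B b -> 0 < e ->
  \forall y \near b, B y -> forall a, C a -> `|f a b - f a y| < e.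
Proof.
move=> cf /compact_near_coveringP cC CA Bb e0.
suff : \forall y \near b, C `<=` [set a | B y -> A a -> `|f a b - f a y| < e].
  by apply: filterS => y H By a Ca; apply: H => //; exact: CA.
apply: cC => a Ca.
have e20 : 0 < e / 2 by rewrite divr_gt0.
have [[V W] /= [aV bW] VW] := within_prod_continuousP cf (CA _ Ca) Bb e20.
exists (V, W) => // -[x y] /= [Vx Wy] By Ax.
rewrite (splitr e) (le_lt_trans (ler_distD (f a b) _ _))// ltrD//.
  by rewrite distrC; apply: (VW (x, b)) => //; split => //; exact: nbhs_singleton.
exact: (VW (x, y)).
Qed.

Lemma within_section1 (T U : topologicalType) (f : T -> U -> R)
    (A : set T) (B : set U) (b : U) :
  {within A `*` B, continuous (fun p => f p.1 p.2)} -> B b ->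
  {within A, continuous (f ^~ b)}.
Proof.
move=> cf Bb; apply/within_continuousP => a Aa e e0.
have [[V W] /= [aV bW] VW] := within_prod_continuousP cf Aa Bb e0.
apply: filterS aV => x Vx Ax; apply: (VW (x, b)) => //.
by split => //; exact: nbhs_singleton.
Qed.

Lemma within_swap (T U : topologicalType) (f : T -> U -> R)
    (A : set T) (B : set U) :
  {within A `*` B, continuous (fun p => f p.1 p.2)} ->
  {within B `*` A, continuous (fun p => f p.2 p.1)}.
Proof.
move=> /within_continuousP cf; apply/within_continuousP => -[b a] [/= Bb Aa] e e0.
have [[V W] /= [aV bW] VW] := cf (a, b) (conj Aa Bb) e e0.
by exists (W, V) => // -[y x] /= [Wy Vx] [By Ax]; apply: (VW (x, y)).
Qed.

Lemma compact_within_bounded (T : topologicalType) (A : set T) (f : T -> R) :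
  compact A -> {within A, continuous f} ->
  exists M, forall x, A x -> `|f x| <= M.
Proof.
move=> cA cf; have := compact_bounded (continuous_compact cf cA).
move=> [M [_ /(_ (M + 1))]]; rewrite ltrDl => /(_ ltr01) fM.
by exists (M + 1) => x Ax; apply: fM; exists x.
Qed.

Lemma valL_val (T V : Type) (v : V) (B : set T) (f : B -> V) (x : B) :
  'valL_ v f (set_val x) = f x.
Proof. exact: (congr1 (@^~ x) (valLK v f)). Qed.

Lemma valL_sigL (T V : Type) (v : V) (B : set T) (u : T -> V) (x : T) :
  B x -> 'valL_ v (sigL B u) x = u x.
Proof.
by move=> Bx; rewrite -[x]/(set_val (SigSub (mem_set Bx))) valL_val.
Qed.

Lemma continuous_set_type (S T : topologicalType) (A : set T) (f : S -> A) :
  continuous (set_val \o f) -> continuous f.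
Proof.
move=> cf x U /nbhs_set_typeP[V xV VU].
by apply: (@filterS _ (nbhs x) _ ((set_val \o f) @^-1` V)) (cf x V xV) => y; exact: VU.
Qed.

Lemma continuous_prod_topology (S : topologicalType) (I : Type)
    (T : I -> topologicalType) (f : S -> prod_topology T) :
  (forall i, continuous (fun x => f x i)) -> continuous f.
Proof.
move=> cf x; apply/cvg_sup => i; move: x.
apply/(@continuousP _ (initial_topology (@^~ i))) => A [B oB <-].
by have /continuousP/(_ B oB) := cf i.
Qed.

End topology.

(** * Integration against measures with a density *)

Section integration.
Context d (T : measurableType d) (R : realType).
Implicit Types (mu nu : probability T R) (f g h k : T -> R).

Lemma bounded_integrable mu (B : set T) f : measurable B ->
  measurable_fun B f -> [bounded f x | x in B] -> mu.-integrable B (EFin \o f).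
Proof.
move=> mB mf bf; apply: measurable_bounded_integrable => //.
by rewrite (le_lt_trans (probability_le1 mu mB))// ltry.
Qed.

(** Radon-Nikodym derivatives, to which this is applied, are determined almost
    everywhere only. *)
Lemma normr_Rintegral_le_ae mu (B : set T) g h : measurable B ->
  mu.-integrable B (EFin \o g) -> mu.-integrable B (EFin \o h) ->
  (forall x, B x -> 0 <= h x) ->
  {ae mu, forall x, B x -> `|g x| <= h x} ->
  `|\int[mu]_(x in B) g x| <= \int[mu]_(x in B) h x.
Proof.
move=> mB ig ih h0 gh; apply: le_trans (le_normr_Rintegral mB ig) _.
have iag : mu.-integrable B (EFin \o (fun x => `|g x|)) by exact: integrable_norm.
rewrite /Rintegral fine_le//; [exact: integrable_fin_num|exact: integrable_fin_num|].
apply: ae_ge0_le_integral => //.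
- exact: measurable_int iag.
- exact: measurable_int ih.
Qed.

(** The version [k] may fail to be measurable; the integrable function [r],
    which agrees with [f * k] almost everywhere, stands in for that product
    under the integral sign. *)
Lemma Rintegral_Radon_Nikodym mu nu (B : set T) f k : nu `<< mu ->
  measurable B -> measurable_fun B f -> [bounded f x | x in B] ->
  EFin \o k = Radon_Nikodym (charge_of_finite_measure nu) mu %[ae mu in B] ->
  exists r, [/\ mu.-integrable B (EFin \o r),
    {ae mu, forall x, B x -> r x = f x * k x} &
    \int[nu]_(x in B) f x = \int[mu]_(x in B) r x].
Proof.
move=> numu mB mf bf kRN.
pose RN := Radon_Nikodym (charge_of_finite_measure nu) mu.
have RNfin x : RN x \is a fin_num by exact: Radon_Nikodym_fin_num.
have iRN : mu.-integrable B RN.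
  by apply: integrableS (Radon_Nikodym_integrable _) => //.
have eqr : EFin \o (fun x => f x * fine (RN x)) = ((EFin \o f) \* RN)%E.
  by apply/funext => x /=; rewrite EFinM fineK.
exists (fun x => f x * fine (RN x)); split.
- by rewrite eqr; exact: integrableMr.
- by apply: filterS kRN => x kx Bx; rewrite -[RN x]kx.
- rewrite /Rintegral -(Radon_Nikodym_change_of_variables numu mB).
    by congr fine; apply: eq_integral => x _; rewrite EFinM fineK.
  exact: bounded_integrable.
Qed.

(** For [f] with [mu]-integral 1 this says that a uniform bound on the
    difference of two densities bounds the difference of the two means. *)
Lemma Rintegral_density_dist mu nu nu' (B : set T) f k k' c :
  nu `<< mu -> nu' `<< mu -> measurable B ->
  measurable_fun B f -> [bounded f x | x in B] -> (forall x, B x -> 0 <= f x) ->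
  EFin \o k = Radon_Nikodym (charge_of_finite_measure nu) mu %[ae mu in B] ->
  EFin \o k' = Radon_Nikodym (charge_of_finite_measure nu') mu %[ae mu in B] ->
  0 <= c -> (forall x, B x -> `|k x - k' x| <= c) ->
  `|\int[nu]_(x in B) f x - \int[nu']_(x in B) f x| <= c * \int[mu]_(x in B) f x.
Proof.
move=> numu numu' mB mf bf f0 kRN kRN' c0 kk'.
have [r [ir rE ->]] := Rintegral_Radon_Nikodym numu mB mf bf kRN.
have [r' [ir' rE' ->]] := Rintegral_Radon_Nikodym numu' mB mf bf kRN'.
have iF : mu.-integrable B (EFin \o f) by exact: bounded_integrable.
rewrite -RintegralB// -RintegralZl//; apply: normr_Rintegral_le_ae => //.
- by rewrite (_ : EFin \o _ = ((EFin \o r) \- (EFin \o r'))%E) //; exact: integrableB.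
- rewrite (_ : EFin \o _ = (fun x => c%:E * (EFin \o f) x)%E)//.
  exact: integrableZl.
- by move=> x Bx; rewrite mulr_ge0// f0.
- apply: filterS2 rE rE' => x rx rx' Bx; rewrite rx// rx'// -mulrBr normrM.
  by rewrite ger0_norm ?f0// mulrC ler_wpM2r ?f0// kk'.
Qed.

(** If the density is within [c] of [a] where [f] lives, then the quotient of
    the integrals of [f] against [nu] and [mu] is within [c] of [a]. *)
Lemma Rintegral_density_near mu nu (B : set T) f k a c :
  nu `<< mu -> measurable B ->
  measurable_fun B f -> [bounded f x | x in B] -> (forall x, B x -> 0 <= f x) ->
  EFin \o k = Radon_Nikodym (charge_of_finite_measure nu) mu %[ae mu in B] ->
  0 <= c -> (forall x, B x -> f x != 0 -> `|k x - a| <= c) ->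
  `|\int[nu]_(x in B) f x - a * \int[mu]_(x in B) f x|
    <= c * \int[mu]_(x in B) f x.
Proof.
move=> numu mB mf bf f0 kRN c0 kk'.
have [r [ir rE ->]] := Rintegral_Radon_Nikodym numu mB mf bf kRN.
have iF : mu.-integrable B (EFin \o f) by exact: bounded_integrable.
have iZ b : mu.-integrable B (EFin \o (fun x => b * f x)).
  rewrite (_ : EFin \o _ = (fun x => b%:E * (EFin \o f) x)%E)//.
  exact: integrableZl.
rewrite -!RintegralZl// -RintegralB//; apply: normr_Rintegral_le_ae => //.
- rewrite (_ : EFin \o _ = ((EFin \o r) \- (EFin \o (fun x => (a * f x)%R)))%E)//.
  exact: integrableB.
- by move=> x Bx; rewrite mulr_ge0// f0.
- apply: filterS rE => x rx Bx; rewrite rx// mulrC -mulrBl normrM.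
  rewrite (ger0_norm (f0 _ Bx)); have [->|fx0] := eqVneq (f x) 0.
    by rewrite !mulr0.
  by rewrite ler_wpM2r ?f0// kk'.
Qed.

(** A nonnegative function of integral zero vanishes almost everywhere, a
    property inherited by dominated measures. *)
Lemma Rintegral_eq0_dominated mu nu (B : set T) f : nu `<< mu ->
  measurable B -> measurable_fun B f -> [bounded f x | x in B] ->
  (forall x, B x -> 0 <= f x) -> \int[mu]_(x in B) f x = 0 ->
  \int[nu]_(x in B) f x = 0.
Proof.
move=> numu mB mf bf f0.
have iF : mu.-integrable B (EFin \o f) by exact: bounded_integrable.
rewrite /Rintegral => int0.
have mEf := measurable_int mu iF.
have [+ _] := ae_eq_integral_abs mu mB mEf.
have -> : (\int[mu]_(x in B) `|(f x)%:E| = 0)%E.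
  transitivity (\int[mu]_(x in B) (f x)%:E)%E.
    by apply: eq_integral => x /set_mem xB; rewrite gee0_abs ?lee_fin ?f0.
  rewrite -[LHS]fineK ?int0//; exact: integrable_fin_num.
move=> /(_ erefl) /(null_dominates_ae_eq mB numu) f0ae.
by rewrite (ae_eq_integral (cst 0%E)) ?integral0.
Qed.

End integration.

Section borel.
Context {R : realType} {X : pmetricType R}.
Implicit Types (B U V W : set X) (f u : X -> R).

Lemma borel_closed B : closed B -> measurable (B : set (borel X)).
Proof.
move=> cB; rewrite -(setCK B); apply: measurableC.
by apply: sub_sigma_algebra; exact: closed_openC.
Qed.

Lemma borel_within_continuous B f : measurable (B : set (borel X)) ->
  {within B, continuous f} -> measurable_fun (B : set (borel X)) f.
Proof.
move=> mB /continuousP cf.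
apply: (measurability _ (RGenOpens.measurableE R)).
move=> _ [_ [a [b ->] <-]].
have /cf/open_subspaceP[V oV VB] : open `]a, b[%classic by exact: interval_open.
rewrite setIC -[X in measurable X]VB.
by apply: measurableI => //; exact: sub_sigma_algebra.
Qed.

Lemma closed_bdry U : closed (bdry U).
Proof.
by apply: closedI; [exact: closed_closure|exact: open_closedC (open_interior _)].
Qed.

Lemma compact_bdry U : compact (closure U) -> compact (bdry U).
Proof.
move=> cU; apply: subclosed_compact cU _; [exact: closed_bdry|exact: subDsetl].
Qed.

Lemma measurable_bdry U : measurable (bdry U : set (borel X)).
Proof. by apply: borel_closed; exact: closed_bdry. Qed.

Lemma bounded_borel_compact B f : compact B -> {within B, continuous f} ->
  bounded_borel B f.
Proof.
move=> cB cf; split.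
  apply: borel_within_continuous => //; apply: borel_closed.
  exact: compact_closed (@metric_hausdorff _ _) cB.
have [M fM] := compact_within_bounded cB cf.
exists M; split; first exact: num_real.
by move=> r /ltW Mr x Bx; exact: le_trans (fM x Bx) Mr.
Qed.

Lemma bounded_borel_indic B (N : set X) : open N ->
  bounded_borel B (\1_N : X -> R).
Proof.
move=> oN; split.
  by apply: measurable_indic; exact: sub_sigma_algebra.
exists 1; split => // M M1 x Bx /=; rewrite indicE ger0_norm ?ler0n//.
by apply: le_trans (ltW M1); rewrite lern1 leq_b1.
Qed.

Lemma bounded_borel_integrable (mu : probability (borel X) R) U f :
  bounded_borel (bdry U) f -> mu.-integrable (bdry U) (EFin \o f).
Proof. by move=> [mf bf]; apply: bounded_integrable => //; exact: measurable_bdry. Qed.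

Lemma compact_open_cover (A : nat -> set X) (C : set X) : compact C ->
  (forall n, open (A n)) -> (forall n, A n `<=` A n.+1) ->
  C `<=` \bigcup_n A n -> exists n, C `<=` A n.
Proof.
move=> /compact_near_coveringP cC oA AS CA.
have [n _ /(_ n (leqnn n)) nC] : \forall n \near \oo, C `<=` A n.
  apply: cC => x /CA[n _ Anx].
  exists (A n, [set m | (n <= m)%N]) => /=.
    by split; [exact: open_nbhs_nbhs|exact: nbhs_infty_ge].
  by move=> [y m] /= [Any nm]; exact: homo_subset Any.
by exists n.
Qed.

End borel.

(** * Harmonic functions *)

Section harmonic_functions.
Context {R : realType} {X : pmetricType R}.
Context (Dfam : set (set X)) (omega : set X -> X -> probability (borel X) R).
Hypothesis framework : harmonic_framework Dfam omega.
Implicit Types (U V W : set X) (u v f : X -> R).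

Local Notation har := (harmonic_on Dfam omega).

Lemma family_open U : Dfam U -> open U.
Proof. by move=> /(framework_domain framework)[]. Qed.

Lemma harmonic_measure_bdry U x : Dfam U -> U x -> omega U x (bdry U) = 1%E.
Proof. by move=> /(framework_measure framework)[_ + _]; apply. Qed.

Lemma harmonic_measure_ac U x y : Dfam U -> U x -> U y ->
  omega U x `<< omega U y.
Proof. by move=> /(framework_measure framework)[_ _]; apply. Qed.

Lemma precompact_in_sub V W W' : W `<=` W' -> precompact_in V W ->
  precompact_in V W'.
Proof. by move=> WW' [cV VW]; split=> //; exact: subset_trans WW'. Qed.

Lemma precompact_in_subset V W : precompact_in V W -> V `<=` W.
Proof. by move=> [_]; exact: subset_trans (@subset_closure _ V). Qed.

Lemma precompact_in_bdry V W : precompact_in V W -> bdry V `<=` W.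
Proof. by move=> [_ VW] x [/VW]. Qed.

Lemma within_bounded_borel V W u : precompact_in V W ->
  {within W, continuous u} -> bounded_borel (bdry V) u.
Proof.
move=> VW cu; apply: bounded_borel_compact.
  by apply: compact_bdry; case: VW.
exact: continuous_subspaceW (precompact_in_bdry VW) cu.
Qed.

Lemma within_integrable (mu : probability (borel X) R) V W u :
  precompact_in V W -> {within W, continuous u} ->
  mu.-integrable (bdry V) (EFin \o u).
Proof.
by move=> VW cu; apply: bounded_borel_integrable; exact: within_bounded_borel VW cu.
Qed.

Lemma harmonic_subset W W' u : W `<=` W' -> har W' u -> har W u.
Proof.
move=> WW' [cu mu]; split; first exact: continuous_subspaceW cu.
by move=> V x DV rV VW; apply: mu => //; exact: precompact_in_sub VW.
Qed.

Lemma harmonic_lincomb W u v (a b : R) : har W u -> har W v ->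
  har W (fun x => a * u x + b * v x).
Proof.
move=> [cu mu] [cv mv]; split.
  move=> x; apply: (@continuousD _ _ (subspace W)); apply: (@continuousM _ (subspace W));
    by [exact: cst_continuous|exact: cu|exact: cv].
move=> V x DV rV VW Vx; rewrite (mu V x)// (mv V x)//.
have iu := within_integrable (omega V x) VW cu.
have iv := within_integrable (omega V x) VW cv.
have mB := measurable_bdry V.
have iZ (c : R) (g : X -> R) : (omega V x).-integrable (bdry V) (EFin \o g) ->
    (omega V x).-integrable (bdry V) (EFin \o (fun y => c * g y)).
  move=> ig; rewrite (_ : EFin \o _ = (fun y => c%:E * (EFin \o g) y)%E)//.
  exact: integrableZl.
by rewrite RintegralD ?RintegralZl//; exact: iZ.
Qed.

Lemma normr_mean_le U x g e : Dfam U -> U x ->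
  (omega U x).-integrable (bdry U) (EFin \o g) -> 0 <= e ->
  (forall y, bdry U y -> `|g y| <= e) ->
  `|\int[omega U x]_(y in bdry U) g y| <= e.
Proof.
move=> DU Ux ig e0 ge; have mB := measurable_bdry U.
have -> : e = \int[omega U x]_(y in bdry U) e.
  rewrite Rintegral_cst// (_ : fine _ = 1) ?mulr1//.
  by rewrite -[RHS]/(fine 1%E); congr fine; exact: harmonic_measure_bdry.
apply: normr_Rintegral_le_ae => //; last exact: aeW.
have : bounded_borel (bdry U) (cst e : X -> R).
  split; first exact: measurable_cst.
  by exists e; split=> [|r /ltW er y _ /=]; [exact: num_real|rewrite ger0_norm].
exact: bounded_borel_integrable.
Qed.

(** Harmonic measures have mass one, so the mean over a boundary moves by at
    most the uniform error. *)
Lemma harmonic_uniform_limit W f :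
  (forall e, 0 < e -> exists2 u, har W u & forall x, W x -> `|f x - u x| < e) ->
  har W f.
Proof.
move=> lim.
have cf : {within W, continuous f}.
  apply/within_continuousP => a Wa e e0.
  have e30 : 0 < e / 3 by rewrite divr_gt0.
  have [u [/within_continuousP cu _] fu] := lim _ e30.
  have := cu a Wa _ e30; apply: filterS => x ux Wx.
  have := ler_distD (u a) (f a) (f x); have := ler_distD (u x) (u a) (f x).
  have := fu a Wa; have := fu x Wx; rewrite (distrC (f x)); have := ux Wx.
  by lra.
split => // V x DV rV VW Vx; apply/eqP; rewrite -subr_eq0 -normr_le0.
apply/ler_addgt0Pr => e e0; rewrite add0r.
have e20 : 0 < e / 2 by rewrite divr_gt0.
have [u hu fu] := lim _ e20.
have mB := measurable_bdry V.
have if_ := within_integrable (omega V x) VW cf.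
have iu := within_integrable (omega V x) VW hu.1.
have : `|\int[omega V x]_(y in bdry V) (u y - f y)| <= e / 2.
  apply: normr_mean_le => //; last 2 first.
  - exact: ltW.
  - by move=> y /(precompact_in_bdry VW) /fu/ltW; rewrite distrC.
  rewrite (_ : EFin \o _ = ((EFin \o u) \- (EFin \o f))%E)//.
  exact: integrableB.
rewrite RintegralB// -hu.2//.
have := fu x (precompact_in_subset VW Vx).
set I := Rintegral _ _ _ => h1 h2.
rewrite (le_trans (ler_distD (u x) _ _))// (splitr e) lerD// ltW//.
Qed.

(** A test domain has compact closure, hence it already lies in one member of
    the exhaustion: harmonicity on the union only has to be tested there. *)
Lemma harmonic_bigcup (A : nat -> set X) u :
  (forall n, open (A n)) -> (forall n, A n `<=` A n.+1) ->
  (forall n, har (A n) u) -> har (\bigcup_n A n) u.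
Proof.
move=> oA AS hu; split.
  apply/within_continuousP => a [n _ Ana] e e0.
  have [/within_continuousP/(_ a Ana e e0) cu _] := hu n.
  near=> x => _; apply: (near cu x) => //; near: x.
  exact: open_nbhs_nbhs.
move=> V x DV rV [cV VA] Vx.
have [n VAn] := compact_open_cover cV oA AS VA.
by apply: (hu n).2.
Unshelve. all: end_near. Qed.

End harmonic_functions.

(** * The relative kernel of one regular domain *)

(** Nonnegativity in place of strict positivity makes this condition closed
    under limits; strict positivity is recovered on regular domains relatively
    compact in [W] by [normalized_harmonic_gt0]. *)
Definition normalized_nonneg (R : realType) (X : pmetricType R)
    (Dfam : set (set X)) (omega : set X -> X -> probability (borel X) R)
    (x0 : X) (W : set X) : set (X -> R) :=
  [set u | [/\ harmonic_on Dfam omega W u, (forall z, W z -> 0 <= u z) &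
                u x0 = 1]].

Section kernel.
Context {R : realType} {X : pmetricType R}.
Context (Dfam : set (set X)) (omega : set X -> X -> probability (borel X) R).
Hypothesis framework : harmonic_framework Dfam omega.
Context (U : set X) (x0 : X) (K : X -> X -> R).
Hypotheses (DU : Dfam U) (regU : regular_domain U (omega U)).
Hypotheses (x0U : U x0) (cU : compact (closure U)).
Hypothesis kerK : relative_kernel U (omega U) x0 K.
Hypothesis contK : {within U `*` bdry U, continuous (fun p => K p.1 p.2)}.
Implicit Types (N V W : set X) (x y : X) (u f : X -> R).

Local Notation har := (harmonic_on Dfam omega).
Local Notation hpos := (normalized_nonneg Dfam omega x0).
Local Notation hit N x := (\int[omega U x]_(y in bdry U) (\1_N : X -> R) y).

Lemma integral_harmonic_measure_continuous f :
  bounded_borel (bdry U) f ->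
  {within U, continuous (fun x => \int[omega U x]_(y in bdry U) f y)}.
Proof.
move=> bf; apply: (framework_continuous framework DU) => x Ux.
by exists f; [exact: bounded_borel_integrable|exact: aeW].
Qed.

(** If the neighbourhood [N] of [y] were null for one base point, it would be
    null for all of them by mutual absolute continuity, whereas regularity makes
    the measure of [N] tend to 1 at [y]. *)
Lemma harmonic_measure_support N x y : open N -> bdry U y -> N y -> U x ->
  0 < hit N x.
Proof.
move=> oN Uy Ny Ux.
have bN := bounded_borel_indic (bdry U) oN.
rewrite lt_def Rintegral_ge0 ?andbT; last by move=> z _; rewrite indicE.
apply/eqP => hit0.
have {}hit0 z : U z -> hit N z = 0.
  move=> Uz; apply: (Rintegral_eq0_dominated (mu := omega U x)) => //.
  - exact: (harmonic_measure_ac framework).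
  - exact: measurable_bdry.
  - exact: bN.1.
  - exact: bN.2.
have fN : (\1_N : X -> R) y = 1 by rewrite indicE mem_set.
have cvN : (\1_N : X -> R) z @[z --> within (bdry U) (nbhs y)] --> (\1_N : X -> R) y.
  rewrite fN; apply: cvg_near_cst; apply: cvg_within.
  by apply: filterS (open_nbhs_nbhs (conj oN Ny)) => z Nz; rewrite indicE mem_set.
have /cvgrPdist_lt/(_ 1 ltr01) := regU Uy bN cvN; rewrite near_withinE => near1.
have [z [Uz /(_ Uz)]] := Uy.1 _ near1.
by rewrite hit0// subr0 fN normr1 ltxx.
Qed.

(** The pointwise value of the continuous version is recovered from the
    measures: the density is within [e] of [K x y] throughout a small enough [N],
    uniformly for [x] in the compact set [C], and [N] is not null. *)
Lemma kernel_near_average C y e : compact C -> C `<=` U -> bdry U y -> 0 < e ->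
  exists N, [/\ open N, N y &
    forall x, C x -> `|hit N x / hit N x0 - K x y| <= e].
Proof.
move=> cC CU Uy e0.
have := tube_continuous contK cC CU Uy e0.
rewrite /prop_near1/= nbhsE => -[N [oN Ny] NK]; exists N; split => // x Cx.
have bN := bounded_borel_indic (bdry U) oN.
have hit0 : 0 < hit N x0 by exact: harmonic_measure_support Uy _ _.
have N0 z : 0 <= (\1_N : X -> R) z by rewrite indicE.
have : `|hit N x - K x y * hit N x0| <= e * hit N x0.
  apply: (@Rintegral_density_near _ (borel X) R (omega U x0) (omega U x)
    (bdry U) (\1_N : X -> R) (K x)) => //.
  - by apply: (harmonic_measure_ac framework) => //; exact: CU.
  - exact: measurable_bdry.
  - exact: bN.1.
  - exact: bN.2.
  - by apply: kerK; exact: CU.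
  - exact: ltW.
  - move=> z Uz; rewrite indicE; case: (boolP (z \in N)); last by rewrite eqxx.
    move=> /set_mem Nz _; rewrite distrC; apply/ltW.
    exact: NK.
rewrite -ler_pdivrMr// -[X in _ / X]ger0_norm; last exact: ltW.
by rewrite -normf_div mulrBl mulfK// gt_eqF.
Qed.

Lemma kernel_ge0 x y : U x -> bdry U y -> 0 <= K x y.
Proof.
move=> Ux Uy; apply/ler_addgt0Pr => e e0.
have [|N [oN Ny NK]] := kernel_near_average (@compact_set1 _ x) _ Uy e0.
  by move=> _ ->.
have := NK x erefl; rewrite ler_norml => /andP[_]; rewrite lerBlDr addrC.
apply: le_trans; apply: divr_ge0; apply: Rintegral_ge0 => z _; by rewrite indicE.
Qed.

Lemma kernel_base y : bdry U y -> K x0 y = 1.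
Proof.
move=> Uy; apply/esym/eqP; rewrite -subr_eq0 -normr_le0.
apply/ler_addgt0Pr => e e0; rewrite add0r.
have [|N [oN Ny NK]] := kernel_near_average (@compact_set1 _ x0) _ Uy e0.
  by move=> _ ->.
have := NK x0 erefl; rewrite divff// gt_eqF//.
exact: harmonic_measure_support Uy _ _.
Qed.

(** The averages over [N] satisfy the mean value property by the compatibility
    of harmonic measures, and they are uniformly close to the kernel on the
    compact closure of the test domain. *)
Lemma kernel_harmonic y : bdry U y -> har U (K ^~ y).
Proof.
move=> Uy; have cK := within_section1 contK Uy.
split => // V x DV rV VU Vx.
have VsubU := precompact_in_subset VU.
apply/eqP; rewrite -subr_eq0 -normr_le0.
apply/ler_addgt0Pr => e e0; rewrite add0r.
have e20 : 0 < e / 2 by rewrite divr_gt0.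
(* The compact set is the whole closure of [V]: it contains the centre [x]
   as well as the boundary over which the mean is taken. *)
have [N [oN Ny NK]] := kernel_near_average VU.1 VU.2 Uy e20.
have bN := bounded_borel_indic (bdry U) oN.
have ch := integral_harmonic_measure_continuous bN.
have mB := measurable_bdry V.
have ihit := within_integrable (omega V x) VU ch.
have iK := within_integrable (omega V x) VU cK.
pose a z := hit N z / hit N x0.
have ia : (omega V x).-integrable (bdry V) (EFin \o a).
  rewrite (_ : EFin \o a =
    (fun z => (hit N x0)^-1%:E * (EFin \o (fun z => hit N z)) z)%E).
    exact: integrableZl.
  by apply/funext => z /=; rewrite /a EFinM muleC.
have aE : a x = \int[omega V x]_(z in bdry V) a z.
  rewrite RintegralZr// /a; congr (_ / _).
  exact: (framework_mean framework).
have clV z : V z -> closure V z by exact: subset_closure.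
have := NK x (clV _ Vx); rewrite -/(a x) {1}aE => h1.
have : `|\int[omega V x]_(z in bdry V) (a z - K z y)| <= e / 2.
  apply: (normr_mean_le framework DV Vx) => //.
  - rewrite (_ : EFin \o _ = ((EFin \o a) \- (EFin \o (K ^~ y)))%E)//.
    exact: integrableB.
  - exact: ltW.
  - by move=> z [Vz _]; exact: NK.
rewrite RintegralB//; move: h1.
rewrite distrC => h1 h2.
rewrite (splitr e); exact: le_trans (ler_distD _ _ _) (lerD h1 h2).
Qed.

(** Both values are means over the boundary of [U], with densities [K x] and
    [K x'] against the probability measure of density [u] with respect to
    [omega U x0]. *)
Lemma normalized_harmonic_oscillation W u x x' c : precompact_in U W ->
  hpos W u ->
  U x -> U x' -> 0 <= c -> (forall y, bdry U y -> `|K x y - K x' y| <= c) ->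
  `|u x - u x'| <= c.
Proof.
move=> UW [hu u0 ux0] Ux Ux' c0 Kc.
have bu := within_bounded_borel UW hu.1.
rewrite (hu.2 U x)// (hu.2 U x')//.
rewrite -[leRHS]mulr1 -ux0 (hu.2 U x0)//.
apply: (@Rintegral_density_dist _ (borel X) R (omega U x0) (omega U x)
  (omega U x') (bdry U) u (K x) (K x')) => //.
- exact: (harmonic_measure_ac framework).
- exact: (harmonic_measure_ac framework).
- exact: measurable_bdry.
- exact: bu.1.
- exact: bu.2.
- by move=> y /(precompact_in_bdry UW) /u0.
- exact: kerK.
- exact: kerK.
Qed.

(** Only the kernel of [U] enters, so one neighbourhood of [x] serves all [W]
    and all [u] at once. *)
Lemma normalized_harmonic_equicontinuous x e : U x -> 0 < e ->
  \forall x' \near x, forall W u, precompact_in U W ->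
    hpos W u -> `|u x - u x'| < e.
Proof.
move=> Ux e0; have e20 : 0 < e / 2 by rewrite divr_gt0.
have near1 := tube_continuous (f := fun y x => K x y) (within_swap contK)
  (compact_bdry cU) (@subset_refl _ _) Ux e20.
have near2 : \forall x' \near x, U x'.
  by apply: open_nbhs_nbhs; split => //; exact: (family_open framework).
apply: filterS2 near1 near2 => x' Kxx' Ux' W u UW hu.
apply: (@le_lt_trans _ _ (e / 2)); last by rewrite ltr_pdivrMr// ltr_pMr// ltr1n.
apply: (normalized_harmonic_oscillation UW hu Ux Ux' (ltW e20)) => y Uy.
by apply: ltW; exact: (Kxx' Ux' y Uy).
Qed.

(** The oscillation estimate against the value 1 at the base point, where the
    kernel is constantly 1. *)
Lemma normalized_harmonic_bounded x : U x ->
  exists M, forall W u, precompact_in U W ->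
    hpos W u -> `|u x| <= M.
Proof.
move=> Ux.
have [M KM] := compact_within_bounded (compact_bdry cU)
  (within_section1 (f := fun y x => K x y) (within_swap contK) Ux).
(* One 1 bounds the kernel at [x0], the other bounds [u x0]. *)
exists (`|M| + 1 + 1) => W u UW hu.
have : `|u x - u x0| <= `|M| + 1.
  apply: (normalized_harmonic_oscillation UW hu Ux x0U).
    by rewrite addr_ge0.
  move=> y Uy; rewrite kernel_base//; apply: le_trans (ler_normB _ _) _.
  by rewrite normr1 lerD2r (le_trans (KM y Uy))// ler_norm.
case: (hu) => _ _ -> h; have := ler_normD (u x - 1) 1; rewrite subrK normr1; lra.
Qed.

(** A minimum principle: if the mean of [u] from [x] is zero, then [u] is zero
    almost everywhere on the boundary for [omega U x], hence for [omega U x0],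
    which contradicts the normalization. *)
Lemma normalized_harmonic_gt0 W u x : precompact_in U W ->
  hpos W u -> U x -> 0 < u x.
Proof.
move=> UW [hu u0 ux0] Ux; have bu := within_bounded_borel UW hu.1.
rewrite lt_def u0 ?andbT; last exact: precompact_in_subset UW _ Ux.
apply/eqP; rewrite (hu.2 U x)// => int0.
have : u x0 = 0; last by rewrite ux0 => /eqP; rewrite oner_eq0.
rewrite (hu.2 U x0)//; apply: (Rintegral_eq0_dominated (mu := omega U x)) => //.
- exact: (harmonic_measure_ac framework).
- exact: measurable_bdry.
- exact: bu.1.
- exact: bu.2.
- by move=> y /(precompact_in_bdry UW) /u0.
Qed.

End kernel.

(** * The exhaustion *)

Section exhaustion.
Context {R : realType} {X : pmetricType R}.
Context (Dfam : set (set X)) (omega : set X -> X -> probability (borel X) R).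
Context (D : set X) (x0 : X) (Dn : nat -> set X) (K : nat -> X -> X -> R).
Hypotheses (framework : harmonic_framework Dfam omega).
Hypotheses (DnDfam : forall n, Dfam (Dn n)).
Hypotheses (Dn_regular : forall n, regular_domain (Dn n) (omega (Dn n))).
Hypotheses (x0D0 : Dn 0%N x0).
Hypotheses (Dn_nested : forall n, precompact_in (Dn n) (Dn n.+1)).
Hypotheses (D_bigcup : D = \bigcup_n Dn n).
Hypotheses (K_kernel : forall n, relative_kernel (Dn n) (omega (Dn n)) x0 (K n)).
Hypotheses (K_continuous : forall n,
  {within Dn n `*` bdry (Dn n), continuous (fun p : X * X => K n p.1 p.2)}).

Local Notation har := (harmonic_on Dfam omega).
Local Notation hpos := (normalized_nonneg Dfam omega x0).
Local Notation H1 := (normalized_harmonic Dfam omega D x0).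
Local Notation L m := (closure (Dn m)).

Lemma Dn_open n : open (Dn n).
Proof. exact: (family_open framework). Qed.

Lemma Dn_subS n : Dn n `<=` Dn n.+1.
Proof. exact: precompact_in_subset. Qed.

Lemma Dn_homo m n : (m <= n)%N -> Dn m `<=` Dn n.
Proof. exact: (homo_subset Dn_subS). Qed.

Lemma closure_Dn_sub m n : (m < n)%N -> L m `<=` Dn n.
Proof. by move=> mn; apply: subset_trans (Dn_nested m).2 _; exact: Dn_homo. Qed.

Lemma closure_Dn_homo m n : (m <= n)%N -> L m `<=` L n.
Proof. by move=> mn; apply: closureS; exact: Dn_homo. Qed.

Lemma Dn_x0 n : Dn n x0.
Proof. exact: Dn_homo (leq0n n) _ x0D0. Qed.

Lemma Dn_subD n : Dn n `<=` D.
Proof. by move=> x Dnx; rewrite D_bigcup; exists n. Qed.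

Lemma Dn_cover x : D x -> exists n, Dn n x.
Proof. by rewrite D_bigcup => -[n _]; exists n. Qed.

Lemma closure_Dn_subD n : L n `<=` D.
Proof. by apply: subset_trans (closure_Dn_sub (ltnSn n)) _; exact: Dn_subD. Qed.

Lemma Dn_precompactD n : precompact_in (Dn n) D.
Proof. by split; [case: (Dn_nested n)|exact: closure_Dn_subD]. Qed.

Lemma hpos_subset W W' : W `<=` W' -> hpos W' `<=` hpos W.
Proof.
move=> WW' u [hu u0 ux0]; split=> //; first exact: harmonic_subset hu.
by move=> z /WW'; exact: u0.
Qed.

Lemma hpos_kernel n y : bdry (Dn n) y -> hpos (Dn n) (fun x => K n x y).
Proof.
move=> Dny; have regn := @Dn_regular n; split.
- exact: (kernel_harmonic framework (DnDfam n) regn (@Dn_x0 n) (@K_kernel n)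
    (@K_continuous n) Dny).
- by move=> x Dx; exact: (kernel_ge0 framework (DnDfam n) regn (@Dn_x0 n)
    (@K_kernel n) (@K_continuous n) Dx Dny).
- exact: (kernel_base framework (DnDfam n) regn (@Dn_x0 n) (@K_kernel n)
    (@K_continuous n) Dny).
Qed.

Lemma hpos_convex W u v (t : R) : 0 <= t -> t <= 1 ->
  hpos W u -> hpos W v ->
  hpos W (fun x => t * u x + (1 - t) * v x).
Proof.
move=> t0 t1 [hu u0 ux0] [hv v0 vx0]; split; first exact: harmonic_lincomb.
- by move=> z Wz; rewrite addr_ge0// mulr_ge0 ?u0 ?v0// subr_ge0.
- by rewrite ux0 vx0 !mulr1 addrC subrK.
Qed.

Lemma hpos_equicontinuous n x e : Dn n x -> 0 < e ->
  \forall x' \near x, forall W u, L n `<=` W -> hpos W u -> `|u x - u x'| < e.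
Proof.
move=> Dnx e0.
have := normalized_harmonic_equicontinuous framework (DnDfam n) (@Dn_regular n) (@Dn_x0 n)
  (Dn_nested n).1 (@K_kernel n) (@K_continuous n) Dnx e0.
by apply: filterS => x' ux' W u LW; apply: ux'; split => //; case: (Dn_nested n).
Qed.

Lemma hpos_bounded n x : Dn n x ->
  exists M, forall W u, L n `<=` W -> hpos W u -> `|u x| <= M.
Proof.
move=> Dnx.
have [M uM] := normalized_harmonic_bounded framework (DnDfam n) (@Dn_regular n)
  (@Dn_x0 n) (Dn_nested n).1 (@K_kernel n) (@K_continuous n) Dnx.
by exists M => W u LW; apply: uM; split => //; case: (Dn_nested n).
Qed.

Lemma normalized_harmonic_valL h : H1 h -> hpos D ('valL_ 0 h).
Proof.
move=> [hh h0 hx0]; split => // x Dx.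
by rewrite -[x]/(set_val (SigSub (mem_set Dx))) valL_val; exact/ltW/h0.
Qed.

(** The membership criterion for both limits and glued functions: strict
    positivity, which the approximation does not preserve, is restored by the
    minimum principle. *)
Lemma normalized_harmonic_limit (h : D -> R) :
  (forall n e, 0 < e -> exists2 u, hpos (Dn n) u &
     forall x, Dn n x -> `|'valL_ 0 h x - u x| < e) -> H1 h.
Proof.
move=> lim.
have limx0 : 'valL_ 0 h x0 = 1.
  apply/eqP; rewrite -subr_eq0 -normr_le0; apply/ler_addgt0Pr => e e0.
  rewrite add0r; have [u [_ _ ux0] hu] := lim 0%N e e0.
  by rewrite -ux0; apply/ltW/hu.
have hh : har D ('valL_ 0 h).
  rewrite [X in harmonic_on _ _ X]D_bigcup.
  apply: harmonic_bigcup => [n||n]; [exact: Dn_open|exact: Dn_subS|].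
  apply: (harmonic_uniform_limit framework) => e e0.
  by have [u [hu _ _] uh] := lim n e e0; exists u.
have h0 x : D x -> 0 <= 'valL_ 0 h x.
  move=> /Dn_cover[n Dnx]; apply/ler_addgt0Pr => e e0.
  have [u [_ u0 _] hu] := lim n e e0.
  have := hu x Dnx; have := u0 x Dnx; rewrite ltr_norml => ? /andP[? _]; lra.
split => // x; rewrite -(valL_val 0 h).
have [n Dnx] := Dn_cover (set_valP x).
exact: (normalized_harmonic_gt0 framework (DnDfam n) (@Dn_regular n) (@Dn_x0 n)
  (Dn_precompactD n) _ Dnx).
Qed.

(** The margin of two indices leaves room for the domain [Dn m.+1], which
    contains [L m] and is relatively compact in [Dn m.+2], so that its kernel
    controls these functions on [L m]. *)
Definition harmonic_restrictions m : set (L m -> R) :=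
  [set sigL (L m) u | u in hpos (Dn m.+2)].

Arguments harmonic_restrictions : clear implicits.

Definition harmonic_compact m : set {uniform L m -> R} :=
  closure (harmonic_restrictions m : set {uniform L m -> R}).

Arguments harmonic_compact : clear implicits.

Lemma harmonic_compactP m (f : L m -> R) :
  harmonic_compact m f <-> forall e, 0 < e -> exists2 u, hpos (Dn m.+2) u &
    forall x : L m, `|f x - u (set_val x)| < e.
Proof.
rewrite /harmonic_compact closure_uniformP; split=> [clf e e0|lim e e0].
  by have [_ [u hu <-] fu] := clf e e0; exists u.
by have [u hu fu] := lim e e0; exists (sigL (L m) u) => //; exists u.
Qed.

Lemma harmonic_compact_approx m (f : L m -> R) e : harmonic_compact m f ->
  0 < e -> exists2 u, hpos (Dn m.+2) u &
    forall x, L m x -> `|'valL_ 0 f x - u x| < e.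
Proof.
move=> /harmonic_compactP Qf e0; have [u hu fu] := Qf e e0; exists u => // x Lx.
by rewrite -[x]/(set_val (SigSub (mem_set Lx))) valL_val.
Qed.

Lemma harmonic_compact_restriction m u : hpos (Dn m.+2) u ->
  harmonic_compact m (sigL (L m) u).
Proof. by move=> hu; apply: subset_closure; exists u. Qed.

Lemma harmonic_compact_kernel m n y : (m + 2 <= n)%N -> bdry (Dn n) y ->
  harmonic_compact m (sigL (L m) (fun x => K n x y)).
Proof.
move=> mn /hpos_kernel Kn; apply: harmonic_compact_restriction.
by apply: hpos_subset Kn; apply: Dn_homo; rewrite -addn2.
Qed.

Lemma harmonic_compact_nonempty m : harmonic_compact m !=set0.
Proof.
have [[y Dy] _ _] := framework_measure framework (DnDfam m.+2).
exists (sigL (L m) (fun x => K m.+2 x y)).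
by apply: harmonic_compact_kernel => //; rewrite addn2.
Qed.

Lemma harmonic_compact_normalized m (g : D -> R) : H1 g ->
  harmonic_compact m (restr 0 (L m) g).
Proof.
move=> /normalized_harmonic_valL hg; apply: harmonic_compact_restriction.
by apply: hpos_subset hg; exact: Dn_subD.
Qed.

Lemma harmonic_compact_compact m : compact (harmonic_compact m).
Proof.
apply: equicontinuous_compact_uniform.
- by apply: compact_set_type; case: (Dn_nested m).
- move=> x e e0.
  have Dx : Dn m.+1 (set_val x) by exact: (closure_Dn_sub (ltnSn m)) (set_valP x).
  apply/nbhs_set_typeP.
  have := hpos_equicontinuous Dx e0.
  rewrite /prop_near1/= => near_x; eexists; first exact: near_x.
  move=> y /= uy _ [u hu <-]; apply: uy hu; exact: closure_Dn_sub.
- move=> x.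
  have Dx : Dn m.+1 (set_val x) by exact: (closure_Dn_sub (ltnSn m)) (set_valP x).
  have [M uM] := hpos_bounded Dx; exists M => _ [u hu <-].
  by apply: uM hu; exact: closure_Dn_sub.
Qed.

Lemma harmonic_compact_convex m :
  convex_set (harmonic_compact m : set (convex_lmodType (L m -> R^o))).
Proof.
move=> f g t /set_mem /harmonic_compactP Qf /set_mem /harmonic_compactP Qg.
apply/mem_set/harmonic_compactP => e e0.
have e20 : 0 < e / 2 by rewrite divr_gt0.
have [u hu fu] := Qf _ e20; have [v hv gv] := Qg _ e20.
have t0 : 0 <= t%:num by exact: ge0.
have t1 : 0 <= 1 - t%:num by rewrite subr_ge0; exact: le1.
exists (fun x => t%:num * u x + (1 - t%:num) * v x).
  by apply: hpos_convex => //; rewrite -subr_ge0.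
move=> x.
rewrite -[X in `|X - _|]/(t%:num * f x + (1 - t%:num) * g x).
rewrite opprD addrACA -!mulrBr; apply: (le_lt_trans (ler_normD _ _)).
rewrite !normrM (ger0_norm t0) (ger0_norm t1).
apply: (@le_lt_trans _ _ (t%:num * (e / 2) + (1 - t%:num) * (e / 2))).
  by rewrite lerD// ler_wpM2l// ltW.
by rewrite -mulrDl addrC subrK mul1r ltr_pdivrMr// ltr_pMr// ltr1n.
Qed.

Lemma harmonic_compact_continuous m (f : L m -> R) :
  harmonic_compact m f -> continuous f.
Proof.
rewrite /harmonic_compact closureEcvg => -[F PF [Ff SF]].
apply: (uniform_limit_continuous PF _ Ff).
have : F (harmonic_restrictions m) by exact: SF.
apply: filterS => _ [u [[cu _] _ _] <-].
apply/subspace_sigL_continuousP; apply: continuous_subspaceW cu.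
exact: closure_Dn_sub.
Qed.

Lemma harmonic_compact_harmonic m (f : L m -> R) :
  harmonic_compact m f -> har (Dn m) ('valL_ 0 f).
Proof.
move=> Qf; apply: (harmonic_uniform_limit framework) => e e0.
have [u [hu _ _] fu] := harmonic_compact_approx Qf e0; exists u.
  by apply: harmonic_subset hu; apply: Dn_homo; exact: leqW (leqnSn m).
by move=> x Dx; apply: fu; exact: subset_closure.
Qed.

Lemma harmonic_compact_restr l m (q : L l -> R) : (m < l)%N ->
  harmonic_compact l q -> harmonic_compact m (restr 0 (L m) q).
Proof.
move=> ml Qq; apply/harmonic_compactP => e e0.
have [u hu qu] := harmonic_compact_approx Qq e0; exists u.
  by apply: hpos_subset hu; apply: Dn_homo; rewrite !ltnS ltnW.
by move=> x; apply: qu; apply: (closure_Dn_homo (ltnW ml)); exact: set_valP.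
Qed.

Lemma restr_continuous l m : (m < l)%N ->
  continuous (restr 0 (L m) : {uniform L l -> R} -> {uniform L m -> R}).
Proof.
move=> ml f A /uniform_ballP[e e0 eA]; apply/uniform_ballP; exists e => // g fg.
apply: eA => x; have Lx := closure_Dn_homo (ltnW ml) (set_valP x).
have restrE (h : L l -> R) : restr 0 (L m) h x = h (SigSub (mem_set Lx)).
  exact: (valL_val 0 h (SigSub (mem_set Lx))).
by rewrite !restrE; exact: fg.
Qed.

Lemma compact_preimage_closure_Dn n : compact (set_val @^-1` (L n) : set D).
Proof.
by apply: compact_preimage_val; [case: (Dn_nested n)|exact: closure_Dn_subD].
Qed.

Lemma preimage_closure_Dn_subS n :
  (set_val @^-1` (L n) : set D) `<=` set_val @^-1` (L n.+1).
Proof. by apply: preimage_subset; exact: closure_Dn_homo. Qed.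

Lemma compact_sub_preimage_closure_Dn (C : set D) : compact C ->
  exists n, C `<=` set_val @^-1` (L n).
Proof.
move=> /compact_image_val cC.
have [|n Cn] := compact_open_cover cC Dn_open Dn_subS.
  by move=> _ [x _ <-]; rewrite -D_bigcup; exact: set_valP.
by exists n => x Cx; apply/subset_closure/Cn; exists x.
Qed.

Lemma nbhs_compact_openP (f : {family compact, D -> R}) A :
  nbhs f A <-> exists n (e : R), 0 < e /\
    [set g : D -> R | forall x : D, L n (set_val x) -> `|f x - g x| < e] `<=` A.
Proof.
exact: (family_compact_ballP _ _ compact_preimage_closure_Dn
  preimage_closure_Dn_subS compact_sub_preimage_closure_Dn).
Qed.

Lemma normalized_harmonic_metrizable : metrizable R H1.
Proof.
apply: metrizable_subset.
exact: (metrizable_family_compact compact_preimage_closure_Dn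
  preimage_closure_Dn_subS compact_sub_preimage_closure_Dn).
Qed.

Lemma normalized_harmonic_compact : compact H1.
Proof.
apply: equicontinuous_compact_family.
- move=> x e e0; have [n Dnx] := Dn_cover (set_valP x).
  apply/nbhs_set_typeP.
  have := hpos_equicontinuous Dnx e0.
  rewrite /prop_near1/= => near_x; eexists; first exact: near_x.
  move=> y /= uy h /normalized_harmonic_valL hh; rewrite -!(valL_val 0 h).
  by apply: uy hh; exact: closure_Dn_subD.
- move=> x; have [n Dnx] := Dn_cover (set_valP x).
  have [M uM] := hpos_bounded Dnx; exists M => h /normalized_harmonic_valL hh.
  by rewrite -(valL_val 0 h); apply: uM hh; exact: closure_Dn_subD.
- move=> h clh; apply: normalized_harmonic_limit => n e e0.
  have [|g [/normalized_harmonic_valL hg gh]] :=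
    clh [set g : D -> R | forall x : D, L n (set_val x) -> `|h x - g x| < e].
    by apply/nbhs_compact_openP; exists n, e; split=> // f.
  exists ('valL_ 0 g); first by apply: hpos_subset hg; exact: Dn_subD.
  move=> x Dnx; have Dx := Dn_subD Dnx.
  rewrite -[x]/(set_val (SigSub (mem_set Dx))) !valL_val.
  by apply: gh; exact: subset_closure.
Qed.

Local Notation lim := (inverse_limit harmonic_compact
  (fun l m => restr 0 (L m) (B := L l))).

(** Any index whose domain contains the point would do, see [glueE]. *)
Definition glue (q : forall m, L m -> R) : D -> R := fun x =>
  'valL_ 0 (q (projT1 (cid (Dn_cover (set_valP x))))) (set_val x).

Lemma glueE (q : forall m, L m -> R) n (x : D) : lim q -> L n (set_val x) ->
  glue q x = 'valL_ 0 (q n) (set_val x).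
Proof.
move=> [_ qr] Lnx; rewrite /glue; case: cid => k /= Dkx.
have qE l m y : (m <= l)%N -> L m y -> 'valL_ 0 (q l) y = 'valL_ 0 (q m) y.
  rewrite leq_eqVlt => /predU1P[->//|ml] Lmy.
  by rewrite -(qr _ _ ml) valL_sigL.
have Lkx : L k (set_val x) by exact: subset_closure.
by have [kn|/ltnW nk] := leqP k n; [apply/esym; exact: qE|exact: qE].
Qed.

Lemma glue_normalized (q : forall m, L m -> R) : lim q -> H1 (glue q).
Proof.
move=> limq; apply: normalized_harmonic_limit => n e e0.
have [u hu qu] := harmonic_compact_approx (limq.1 n) e0; exists u.
  by apply: hpos_subset hu; apply: Dn_homo; exact: leqW (leqnSn n).
move=> x Dnx; have Dx := Dn_subD Dnx; have Lx := subset_closure Dnx.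
rewrite -[X in 'valL_ 0 (glue q) X]/(set_val (SigSub (mem_set Dx))) valL_val.
by rewrite (@glueE _ n (SigSub (mem_set Dx)) limq Lx); exact: qu.
Qed.

Lemma restrictions_lim (g : D -> R) : H1 g -> lim (fun m => restr 0 (L m) g).
Proof.
move=> hg; split=> [m|l m ml]; first exact: harmonic_compact_normalized.
apply/funext => x; apply: (valL_sigL 0 ('valL_ 0 g)).
exact: (closure_Dn_homo (ltnW ml)) (set_valP x).
Qed.

Lemma homeomorphic_inverse_limit : homeomorphic H1 lim.
Proof.
pose F (g : H1) : lim := SigSub (mem_set (restrictions_lim (set_valP g))).
pose G (q : lim) : H1 := SigSub (mem_set (glue_normalized (set_valP q))).
exists F, G; split.
- apply: continuous_set_type; apply: continuous_prod_topology => m g A.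
  move=> /uniform_ballP[e e0 eA]; apply/nbhs_set_typeP.
  exists [set f : D -> R | forall x : D, L m (set_val x) -> `|set_val g x - f x| < e].
    by apply/nbhs_compact_openP; exists m, e; split=> // f.
  move=> f /= gf; apply: eA => x.
  have Lx := set_valP x; have Dx := closure_Dn_subD Lx.
  have restrE (h : D -> R) : restr 0 (L m) h x = h (SigSub (mem_set Dx)).
    exact: (valL_val 0 h (SigSub (mem_set Dx))).
  suff : `|restr 0 (L m) (set_val g : D -> R) x
          - restr 0 (L m) (set_val f : D -> R) x| < e by [].
  by rewrite !restrE; exact: gf.
- apply: continuous_set_type => q A.
  move=> /nbhs_compact_openP[n [e [e0 eA]]]; apply/nbhs_set_typeP.
  exists [set p | forall x : L n, `|set_val q n x - p n x| < e].
    have ball_nbhs : nbhs (set_val q n : {uniform L n -> R})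
        [set f : L n -> R | forall x, `|set_val q n x - f x| < e].
      by apply/uniform_ballP; exists e.
    exact: (@proj_continuous nat (fun m => {uniform L m -> R}) n (set_val q)
      _ ball_nbhs).
  move=> p /= qp; apply: eA => x Lx.
  suff : `|glue (\val q) x - glue (\val p) x| < e by [].
  rewrite (glueE (set_valP q) Lx) (glueE (set_valP p) Lx).
  rewrite -[set_val x]/(set_val (SigSub (mem_set Lx))) !valL_val.
  exact: qp.
- move=> g; apply: val_inj; apply/funext => x /=.
  have [n Dnx] := Dn_cover (set_valP x); have Lnx := subset_closure Dnx.
  rewrite (glueE (restrictions_lim (set_valP g)) Lnx) valL_sigL// valL_val.
  by [].
- move=> q; apply: val_inj; apply: functional_extensionality_dep => m.
  apply/funext => x; have Lx := set_valP x; have Dx := closure_Dn_subD Lx.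
  transitivity (glue (\val q) (SigSub (mem_set Dx))).
    exact: (valL_val 0 (glue (\val q)) (SigSub (mem_set Dx))).
  rewrite (@glueE _ m (SigSub (mem_set Dx)) (set_valP q) Lx).
  exact: (valL_val 0 (\val q m) x).
Qed.

End exhaustion.

Arguments harmonic_compact {R X} Dfam omega x0 Dn m _.

Unset Implicit Arguments.
Set Strict Implicit.
Set Printing Implicit Defensive.

Theorem lemma4p1 (R : realType) (X : pmetricType R)
  (Dfam : set (set X)) (omega : set X -> X -> probability (borel X) R)
  (D : set X) (x0 : X) (Dn : nat -> set X) (K : nat -> X -> X -> R)
  (framework : harmonic_framework Dfam omega)
  (domainD : is_domain D) (x0D : D x0)
  (DnDfam : forall n, Dfam (Dn n))
  (Dn_regular : forall n, regular_domain (Dn n) (omega (Dn n)))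
  (x0D0 : Dn 0%N x0)
  (Dn_nested : forall n, precompact_in (Dn n) (Dn n.+1))
  (D_bigcup : D = \bigcup_n Dn n)
  (K_kernel : forall n, relative_kernel (Dn n) (omega (Dn n)) x0 (K n))
  (K_continuous : forall n,
    {within Dn n `*` bdry (Dn n), continuous (fun p : X * X => K n p.1 p.2)}) :
  [/\ compact (normalized_harmonic Dfam omega D x0),
      metrizable R (normalized_harmonic Dfam omega D x0) &
      exists Q : forall m, set {uniform closure (Dn m) -> R},
        [/\ (forall m,
               [/\ Q m !=set0, compact (Q m),
                   convex_set (Q m : set (convex_lmodType (closure (Dn m) -> R^o))),
                   Q m `<=` [set f | continuous (f : closure (Dn m) -> R)] &
                   Q m `<=` [set f | harmonic_on Dfam omega (Dn m) ('valL_ 0 f)]]),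
            (forall m (g : D -> R), normalized_harmonic Dfam omega D x0 g ->
               Q m (restr 0 (closure (Dn m)) g)),
            (forall m n y, (m + 2 <= n)%N -> bdry (Dn n) y ->
               Q m (sigL (closure (Dn m)) (fun x => K n x y))),
            (forall l m, (m < l)%N ->
               (forall q, Q l q -> Q m (restr 0 (closure (Dn m)) q)) /\
               {within Q l, continuous
                  (restr 0 (closure (Dn m)) :
                     {uniform closure (Dn l) -> R} ->
                     {uniform closure (Dn m) -> R})}) &
            homeomorphic (normalized_harmonic Dfam omega D x0)
              (inverse_limit Q
                 (fun l m => restr 0 (closure (Dn m)) (B := closure (Dn l))))]].
Proof.
split.
- exact: (normalized_harmonic_compact framework DnDfam Dn_regular x0D0 Dn_nested
    D_bigcup K_kernel K_continuous).
- exact: (normalized_harmonic_metrizable x0 framework DnDfam Dn_nested D_bigcup).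
exists (harmonic_compact Dfam omega x0 Dn); split.
- move=> m; split.
  + exact: (harmonic_compact_nonempty framework DnDfam Dn_regular x0D0 Dn_nested
      K_kernel K_continuous).
  + exact: (harmonic_compact_compact framework DnDfam Dn_regular x0D0 Dn_nested
      K_kernel K_continuous).
  + exact: harmonic_compact_convex.
  + exact: (harmonic_compact_continuous Dn_nested).
  + exact: (harmonic_compact_harmonic framework Dn_nested).
- by move=> m g; exact: (harmonic_compact_normalized D_bigcup).
- move=> m n y; exact: (harmonic_compact_kernel framework DnDfam Dn_regular x0D0
    Dn_nested K_kernel K_continuous).
- move=> l m ml; split; first by move=> q; exact: (harmonic_compact_restr Dn_nested).
  by apply: continuous_subspaceT; exact: (restr_continuous Dn_nested).
- exact: (homeomorphic_inverse_limit framework DnDfam Dn_regular x0D0 Dn_nested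
    D_bigcup).
Qed.
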